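(* For every real $\alpha > \sqrt{2}$, the series $\sum_{n=1}^\infty \frac{1}{Z(n)^\alpha}$ is convergent.
   Context: For a positive integer $m$ let $T(m) = m(m+1)/2$. The pseudo-Smarandache function is defined for positive integers $n$ by $Z(n) = \min\{ m \ge 1 : n \mid T(m) \}$. *)

(* Defs.v *)
From mathcomp Require Import all_boot.

Set Implicit Arguments.
Unset Strict Implicit.
Unset Printing Implicit Defensive.

Definition triangular (m : nat) : nat := (m * m.+1) %/ 2.

Lemma pseudo_smarandache_ex (n : nat) :
  0 < n -> exists m, (0 < m) && (n %| triangular m).
Proof.
case: n => // n _; exists n.+1.*2.-1.
rewrite /triangular prednK ?double_gt0 // -muln2 mulnA mulnK //.
by rewrite dvdn_mull // andbT mulSn.
Qed.

(* No [m >= 1] has [0 %| triangular m], so the minimum is only taken for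
   [n >= 1]; the value at [0] is a placeholder. *)
Definition pseudo_smarandache (n : nat) : nat :=
  match n with
  | 0 => 0
  | n'.+1 => ex_minn (@pseudo_smarandache_ex n'.+1 (ltn0Sn n'))
  end.

(* Main.v *)
(** At most [d (T m)] integers [n] satisfy [Z n = m], where [d] counts divisors,
    and [d (T m) <= d m * d (m + 1)], so the series is dominated by a multiple of
    [\sum_m (d m)^2 / m^alpha].  Since [d (a b) <= d a * d b], grouping the pairs
    [(a, b)] by their product gives
    [\sum_m d m * F m <= (\sum_m F m)^2] for every submultiplicative [F >= 0];
    applying this twice bounds the series by a multiple of
    [(\sum_m m^-alpha)^4], which is finite already for [alpha > 1]. *)
Require Import Defs.
From mathcomp Require Import all_boot all_order all_algebra.
From mathcomp Require Import all_classical all_reals all_analysis.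
From mathcomp Require Import lra.
Import Order.TTheory GRing.Theory Num.Theory.
Import numFieldNormedType.Exports.

Set Implicit Arguments.
Unset Strict Implicit.
Unset Printing Implicit Defensive.

Local Open Scope classical_set_scope.
Local Open Scope ring_scope.

Definition num_divisors (n : nat) : nat := size (divisors n).

Lemma num_divisors_dvd (m n : nat) : (0 < n)%N -> (m %| n)%N ->
  (num_divisors m <= num_divisors n)%N.
Proof.
move=> n0 mn; have m0 := dvdn_gt0 n0 mn.
apply: uniq_leq_size (divisors_uniq m) _ => d.
by rewrite -!dvdn_divisors // => /dvdn_trans; apply.
Qed.

(** A divisor [d] of [a * b] factors as [gcdn d a], which divides [a], times [d %/ gcdn d a], which
    divides [b] because it is coprime to [a %/ gcdn d a]. So all divisors occur among the pairwise
    products. *)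
Lemma num_divisorsM (a b : nat) : (0 < a)%N -> (0 < b)%N ->
  (num_divisors (a * b) <= num_divisors a * num_divisors b)%N.
Proof.
move=> a0 b0; rewrite -(size_allpairs muln).
apply: uniq_leq_size (divisors_uniq _) _ => d.
rewrite -dvdn_divisors ?muln_gt0 ?a0 // => dab.
have g0 : (0 < gcdn d a)%N by rewrite gcdn_gt0 a0 orbT.
apply/allpairsP; exists (gcdn d a, d %/ gcdn d a)%N; split => /=.
- by rewrite -dvdn_divisors // dvdn_gcdr.
- rewrite -dvdn_divisors // -(@Gauss_dvdr _ (a %/ gcdn d a)).
    by rewrite -(@dvdn_pmul2l (gcdn d a)) // mulnA !(mulnC (gcdn d a)) !divnK
      ?dvdn_gcdl ?dvdn_gcdr.
  rewrite /coprime -(@eqn_pmul2r (gcdn d a)) // mul1n muln_gcdl !divnK //.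
    exact: dvdn_gcdr.
  exact: dvdn_gcdl.
- by rewrite mulnC divnK // dvdn_gcdl.
Qed.

Lemma num_divisors_triangular (m : nat) : (0 < m)%N ->
  (num_divisors (triangular m) <= num_divisors m * num_divisors m.+1)%N.
Proof.
move=> m0; apply: leq_trans _ (num_divisorsM m0 (ltn0Sn m)).
apply: num_divisors_dvd; first by rewrite muln_gt0 m0.
(* One of two consecutive integers is even, so the halving in [triangular] is exact. *)
by apply: dvdn_div; rewrite dvdn2 oddM /= andbN.
Qed.

Lemma triangular_gt0 (m : nat) : (0 < m)%N -> (0 < triangular m)%N.
Proof. by case: m => // m _; rewrite /triangular divn_gt0 //= mulnS. Qed.

Lemma pseudo_smarandacheP (n : nat) : (0 < n)%N ->
  (0 < pseudo_smarandache n)%N && (n %| triangular (pseudo_smarandache n))%N.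
Proof. by case: n => // n _ /=; case: ex_minnP. Qed.

Lemma ler_sum_uniq_sub (R : numDomainType) (I : eqType) (s t : seq I)
    (F : I -> R) :
  uniq s -> uniq t -> {subset s <= t} -> (forall i, 0 <= F i) ->
  \sum_(i <- s) F i <= \sum_(i <- t) F i.
Proof.
move=> us ut st F0; rewrite [leRHS](bigID (mem s)) /=.
rewrite -[X in _ <= X + _]big_filter (perm_big [seq i <- t | i \in s]) /=.
  by rewrite lerDl sumr_ge0.
apply: uniq_perm; rewrite ?filter_uniq // => i.
by rewrite mem_filter /=; case: (boolP (i \in s)) => // /st ->.
Qed.

Lemma sum_divisors_const (V : nmodType) (m : nat) (x : V) :
  \sum_(a <- divisors m) x = x *+ num_divisors m.
Proof. by rewrite big_const_seq count_predT iter_addr addr0. Qed.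

Definition submultiplicative (R : numDomainType) (F : nat -> R) : Prop :=
  forall a b, (0 < a)%N -> (0 < b)%N -> F (a * b)%N <= F a * F b.

(** The divisor count is itself submultiplicative; this is what lets [sum_num_divisors_le] be
    iterated. *)
Lemma submultiplicative_num_divisors (R : numDomainType) (F : nat -> R) :
  (forall n, 0 <= F n) -> submultiplicative F ->
  submultiplicative (fun n => F n *+ num_divisors n).
Proof.
move=> F0 Fsub a b a0 b0; rewrite mulrnAl mulrnAr -mulrnA.
apply: le_trans (_ : _ <= F (a * b)%N *+ (num_divisors a * num_divisors b)) _.
  by rewrite ler_wpMn2l // num_divisorsM.
by rewrite (mulnC (num_divisors a)) lerMn2r Fsub ?orbT.
Qed.

Lemma sum_num_divisors_le (R : numDomainType) (F : nat -> R) (M : nat) :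
  (forall n, 0 <= F n) -> submultiplicative F ->
  \sum_(1 <= m < M.+1) F m *+ num_divisors m <= (\sum_(1 <= m < M.+1) F m) ^+ 2.
Proof.
move=> F0 Fsub.
have -> : \sum_(1 <= m < M.+1) F m *+ num_divisors m =
    \sum_(1 <= m < M.+1) \sum_(1 <= a < M.+1 | (a %| m)%N) F m.
  apply: eq_big_nat => m /andP[m0 mM].
  rewrite -sum_divisors_const -[RHS]big_filter; apply: perm_big.
  apply: uniq_perm; rewrite ?divisors_uniq ?filter_uniq ?iota_uniq // => a.
  rewrite -dvdn_divisors // mem_filter mem_index_iota.
  case: (boolP (a %| m)%N) => //= am.
  by rewrite (dvdn_gt0 m0 am) ltnS (leq_trans (dvdn_leq m0 am)).
rewrite (exchange_big_dep predT) //= expr2 mulr_suml.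
apply: ler_sum_nat => a /andP[a0 aM].
rewrite mulr_sumr -big_filter.
(* The multiples of [a] up to [M] are among the products [a * b] with [b <= M]; the extra products
   only add nonnegative terms. *)
apply: le_trans (_ : _ <= \sum_(1 <= b < M.+1) F (a * b)%N) _; last first.
  by apply: ler_sum_nat => b /andP[b0 _]; apply: Fsub.
rewrite -[leRHS](big_map (muln a) predT F).
apply: ler_sum_uniq_sub => //.
- by rewrite filter_uniq ?iota_uniq.
- rewrite map_inj_uniq ?iota_uniq // => x y /eqP.
  by rewrite eqn_pmul2l // => /eqP.
- move=> m; rewrite mem_filter mem_index_iota => /andP[am /andP[m0 mM]].
  apply/mapP; exists (m %/ a)%N; last by rewrite mulnC divnK.
  rewrite mem_index_iota divn_gt0 // dvdn_leq //=.
  exact: leq_ltn_trans (leq_div _ _) mM.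
Qed.

Lemma sum_fibers_le (R : numDomainType) (F : nat -> R) (N : nat) :
  (forall n, 0 <= F n) ->
  exists M, \sum_(1 <= n < N.+1) F (pseudo_smarandache n) <=
    \sum_(1 <= m < M.+1) F m *+ num_divisors (triangular m).
Proof.
(* With the largest value as cutoff, every [n <= N] lies in exactly one fiber over some [m <= M]. *)
move=> F0; exists (\max_(1 <= n < N.+1) pseudo_smarandache n)%N.
set M := (\max_(1 <= n < N.+1) _)%N.
have -> : \sum_(1 <= n < N.+1) F (pseudo_smarandache n) =
    \sum_(1 <= n < N.+1) \sum_(1 <= m < M.+1 | pseudo_smarandache n == m) F m.
  apply: eq_big_nat => n nN; have /andP[n0 _] := nN.
  rewrite (eq_bigl (pred1 (pseudo_smarandache n))); last first.
    by move=> m; rewrite /= eq_sym.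
  rewrite -big_filter filter_pred1_uniq ?iota_uniq ?big_seq1 //.
  rewrite mem_index_iota ltnS; have /andP[-> _] /= := pseudo_smarandacheP n0.
  by rewrite leq_bigmax_seq ?mem_index_iota.
rewrite (exchange_big_dep predT) //=.
apply: ler_sum_nat => m /andP[m0 _].
rewrite -sum_divisors_const -big_filter.
apply: ler_sum_uniq_sub; rewrite ?filter_uniq ?iota_uniq ?divisors_uniq // => n.
rewrite mem_filter mem_index_iota => /and3P[/eqP Zn n0 _].
rewrite -dvdn_divisors ?triangular_gt0 // -Zn.
by have /andP[] := pseudo_smarandacheP n0.
Qed.

Section Zeta.
Variables (R : realType) (s : R).

Let f (n : nat) : R := (n%:R `^ s)^-1.

Let f_ge0 n : 0 <= f n. Proof. by rewrite invr_ge0 powR_ge0. Qed.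

Let fM a b : f (a * b)%N = f a * f b.
Proof. by rewrite /f natrM powRM // invfM. Qed.

Let f1 : f 1 = 1. Proof. by rewrite /f powR1 invr1. Qed.

Let f_nincr a b : 0 <= s -> (0 < a)%N -> (a <= b)%N -> f b <= f a.
Proof.
move=> s0 a0 ab; rewrite /f lef_pV2 ?posrE ?powR_gt0 ?ltr0n //; last first.
  exact: leq_trans ab.
by rewrite ge0_ler_powR ?nnegrE ?ler_nat.
Qed.

(* Comparing the terms [2k] and [2k + 1] with the term [k] gives
   [S M <= S (2M + 1) <= 1 + 2^(1 - s) * S M] for the partial sums [S]. *)
Lemma zeta_partial_le : 1 < s ->
  exists C : R, forall M, \sum_(1 <= n < M.+1) f n <= C.
Proof.
move=> s1; have s0 : 0 <= s by lra.
(* The ratio [2 * f 2] is thus below 1, and the inequality [S <= 1 + 2 * f 2 * S] can be solved for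
   [S]. *)
have f2 : f 2 < 2^-1.
  rewrite /f ltf_pV2 ?posrE ?powR_gt0 ?ltr0n //.
  by rewrite -[ltLHS](@powRr1 R) // /powR pnatr_eq0 /= ltr_expR ltr_pM2r //
      ln_gt0 ?ltr1n.
have step M : \sum_(1 <= n < (M.*2.+1).+1) f n <=
    1 + 2 * f 2 * \sum_(1 <= n < M.+1) f n.
  elim: M => [|M IH].
    by rewrite big_nat1 f1 [\sum_(1 <= n < 1) _]big_geq // mulr0 addr0.
  rewrite doubleS ![\sum_(1 <= n < _.+2) _]big_nat_recr //=.
  have e : f M.*2.+2 = f 2 * f M.+1 by rewrite -fM -doubleS -mul2n.
  have le1 : f M.*2.+3 <= f M.*2.+2 by exact: f_nincr.
  by rewrite e in le1 *; move: IH; rewrite big_nat_recr //=; lra.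
exists (1 - 2 * f 2)^-1 => M.
set S := \sum_(1 <= n < M.+1) f n.
have SM : S <= 1 + 2 * f 2 * S.
  apply: le_trans _ (step M); rewrite [leRHS](@big_cat_nat _ _ _ M.+1) //=.
    by rewrite lerDl sumr_ge0.
  by rewrite ltnS (leq_trans _ (leqnSn _)) // -addnn leq_addr.
have q0 : 0 < 1 - 2 * f 2 by lra.
by rewrite -[leRHS]mul1r ler_pdivlMr //; lra.
Qed.

Lemma sum_sqr_num_divisors_le : 1 < s ->
  exists C : R, forall M,
    \sum_(1 <= n < M.+1) f n *+ num_divisors n *+ num_divisors n <= C.
Proof.
(* [C] bounds the sums of [f]; each factor [num_divisors] squares the bound. *)
move=> /zeta_partial_le[C SC]; exists ((C ^+ 2) ^+ 2) => M.
have fsub : submultiplicative f by move=> a b _ _; rewrite fM.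
have fd0 n : 0 <= f n *+ num_divisors n by rewrite mulrn_wge0.
apply: le_trans (sum_num_divisors_le M fd0
  (submultiplicative_num_divisors f_ge0 fsub)) _.
have S0 : 0 <= \sum_(1 <= n < M.+1) f n by rewrite sumr_ge0.
apply: lerXn2r; rewrite ?nnegrE ?sumr_ge0 ?exprn_ge0 ?(le_trans S0 (SC M)) //.
apply: le_trans (sum_num_divisors_le M f_ge0 fsub) _.
by apply: lerXn2r; rewrite ?nnegrE ?(le_trans S0 (SC M)).
Qed.

(** The mixed product of the divisor counts of [m] and [m.+1] is separated by [2xy <= x^2 + y^2],
    leaving the square sum and its shift by one. *)
Lemma sum_num_divisors_triangular_le : 1 < s ->
  exists C : R, forall M,
    \sum_(1 <= m < M.+1) f m *+ num_divisors (triangular m) <= C.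
Proof.
move=> s1; have s0 : 0 <= s by lra.
have [C SC] := sum_sqr_num_divisors_le s1.
pose g n := f n *+ num_divisors n *+ num_divisors n.
have g0 n : 0 <= g n by rewrite !mulrn_wge0.
exists (C + (f 2)^-1 * C) => M.
have f2 : 0 < f 2 by rewrite invr_gt0 powR_gt0.
apply: le_trans (_ : _ <= \sum_(1 <= m < M.+1) (g m + (f 2)^-1 * g m.+1)) _.
  apply: ler_sum_nat => m /andP[m0 _].
  (* Since [m + 1 <= 2m], moving the weight from [m] to [m.+1] costs at most the constant
     [(f 2)^-1]. *)
  have fS : f m <= (f 2)^-1 * f m.+1.
    rewrite mulrC ler_pdivlMr // mulrC -fM.
    by apply: f_nincr => //; rewrite mul2n -addnn -addn1 leq_add2l.
  apply: le_trans (_ : _ <= f m *+ (num_divisors m * num_divisors m.+1)) _.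
    by rewrite ler_wpMn2l // num_divisors_triangular.
  have natE (x : R) a b : x *+ (a * b)%N = x * (a%:R * b%:R).
    by rewrite -[LHS]mulr_natr natrM.
  rewrite /g -!mulrnA !natE.
  set x := (num_divisors m)%:R : R; set y := (num_divisors m.+1)%:R : R.
  have xy : 2 * (x * y) <= x * x + y * y.
    by have := sqr_ge0 (x - y); rewrite expr2; lra.
  have xx : 0 <= x * x by rewrite mulr_ge0.
  have yy : 0 <= y * y by rewrite mulr_ge0.
  apply: le_trans (_ : _ <= f m * (x * x) + f m * (y * y)) _.
    by rewrite -mulrDr ler_wpM2l //; lra.
  by rewrite lerD2l [leRHS]mulrA ler_wpM2r.
rewrite big_split /= -mulr_sumr lerD ?SC // ler_wpM2l ?invr_ge0 //.
(* The shifted sum is the sum up to [M.+1] without its first term [g 1]. *)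
apply: le_trans _ (SC M.+1).
by rewrite [leRHS]big_nat_recl //= lerDr (g0 1%N).
Qed.

End Zeta.

Theorem theorem5 (R : realType) (alpha : R) (halpha : Num.sqrt 2 < alpha) :
  cvgn (fun N : nat =>
    \sum_(1 <= n < N.+1) 1 / ((pseudo_smarandache n)%:R `^ alpha) : R).
Proof.
have alpha1 : 1 < alpha.
  apply: le_lt_trans _ halpha.
  by rewrite -[leLHS](@sqrtr1 R) ler_sqrt ?ler1n.
have [C SC] := sum_num_divisors_triangular_le alpha1.
apply: nondecreasing_is_cvgn.
  apply/nondecreasing_seqP => N; rewrite [leRHS]big_nat_recr //= lerDl.
  by rewrite div1r invr_ge0 powR_ge0.
exists C => _ [N _ <-].
(* [M] varies with [N], but [C] serves for every [M], so the partial sums are uniformly bounded. *)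
have [|M ZM] := @sum_fibers_le R (fun n => (n%:R `^ alpha)^-1) N.
  by move=> n; rewrite invr_ge0 powR_ge0.
under eq_bigr do rewrite div1r.
exact: le_trans ZM (SC M).
Qed.
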